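(* Let ${\bf u}\in\mathcal A^{\mathbb N}$ be a fixed point of a primitive morphism $\varphi$ over a binary alphabet $\mathcal A$. If $D({\bf u})<+\infty$, then $D({\bf u})=0$ or ${\bf u}$ is periodic.
   Context: A morphism $\varphi:\mathcal A^*\to\mathcal A^*$ is primitive if there is $k$ such that every letter occurs in $\varphi^k(a)$ for every letter $a$; ${\bf u}$ is a fixed point if $\varphi({\bf u})={\bf u}$. Palindromic defect: for a finite word $w$ of length $n$, $D(w)=n+1-$(number of distinct palindromic factors of $w$, including the empty word), and $D({\bf u})=\sup D(w)$ over factors $w$ of ${\bf u}$. *)

(* Defs.v *)
From mathcomp Require Import all_boot all_order all_algebra.
Set Implicit Arguments. Unset Strict Implicit. Unset Printing Implicit Defensive.
Import GRing.Theory Num.Theory.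

Definition morph (A : eqType) (phi : A -> seq A) (w : seq A) : seq A :=
  flatten (map phi w).

Definition primitive (A : finType) (phi : A -> seq A) : Prop :=
  exists k : nat, forall a b : A, b \in iter k (morph phi) [:: a].

Definition prefix (A : Type) (u : nat -> A) (n : nat) : seq A := mkseq u n.

Definition factor_at (A : Type) (u : nat -> A) (i n : nat) : seq A :=
  mkseq (fun k => u (i + k)) n.

(* phi(u) = u: the image phi(u) of the infinite word u is the limit of
   phi(prefix u n); so phi(u) = u iff every phi(prefix u n) is a prefix of u
   (phi is non-erasing when primitive, so these images have unbounded length). *)
Definition fixed_point (A : eqType) (phi : A -> seq A) (u : nat -> A) : Prop :=
  forall n, morph phi (prefix u n) = prefix u (size (morph phi (prefix u n))).

Definition factors (A : eqType) (w : seq A) : seq (seq A) :=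
  [seq take j (drop i w) | i <- iota 0 (size w).+1, j <- iota 0 (size w).+1].

Definition pal_factors (A : eqType) (w : seq A) : seq (seq A) :=
  undup [seq f <- factors w | rev f == f].

Definition defect (A : eqType) (w : seq A) : int :=
  ((size w)%:Z + 1 - (size (pal_factors w))%:Z)%R.

Definition finite_defect (A : eqType) (u : nat -> A) : Prop :=
  exists M : int, forall i n, (defect (factor_at u i n) <= M)%R.

(* D(u) = 0 : sup of D(w) over factors is 0 (all defects are >= 0 anyway) *)
Definition zero_defect (A : eqType) (u : nat -> A) : Prop :=
  forall i n, defect (factor_at u i n) = 0%R.

Definition periodic (A : Type) (u : nat -> A) : Prop :=
  exists p : nat, 0 < p /\ forall n, u (n + p) = u n.

(* Main.v *)
Require Import Defs.
From mathcomp Require Import all_boot all_order all_algebra.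
From mathcomp Require Import zify.

Set Implicit Arguments. Unset Strict Implicit. Unset Printing Implicit Defensive.

(* Call [w] strong when every [a w b], up to reversal, is a factor.

   A finite word of positive defect has a strong non-palindromic factor.  Let
   Gamma_n be the graph whose vertices are the factors of length n and whose
   edges are the non-palindromic factors of length n+1, all up to reversal.
   The sum of its Euler characteristics over n counts the palindromic factors.
   The Euler characteristic is 1 for n = 0, and passing from n to n+1 can lower
   it only at a strong non-palindrome of length n.

   In an infinite word of finite defect the strong non-palindromes are bounded
   in length: when the last of the four classes [a w b] first appears, no new
   palindrome is created, so the defect of the prefix increases.

   If phi(0) and phi(1) do not commute, then conjugation gives
   phi(a) p = p beta(a).. and s phi(a) = ..alpha(a) s with alpha and beta
   injective, so w |-> s phi(w) p preserves strength, and its square preserves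
   non-palindromicity because alpha^2 = beta^2 = id.  One strong non-palindrome
   thus yields arbitrarily long ones.  If phi(0) and phi(1) commute, u is
   periodic. *)

(** * Palindromic factors of finite words *)

Lemma rev_cons_rcons (A : Type) (a b : A) (w : seq A) :
  rev (a :: rcons w b) = b :: rcons (rev w) a.
Proof. by rewrite rev_cons rev_rcons. Qed.

Lemma mem_factors (A : eqType) (w f : seq A) : (f \in factors w) = infix f w.
Proof.
apply/allpairsP/infixP => [[[i j] /= [_ _ ->]]|[s [s' ->]]].
  exists (take i w), (drop j (drop i w)).
  by rewrite cat_take_drop cat_take_drop.
exists (size s, size f); rewrite !mem_iota !size_cat /=; split; try lia.
by rewrite drop_size_cat // take_size_cat.
Qed.

Lemma mem_pal_factors (A : eqType) (w f : seq A) :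
  (f \in pal_factors w) = infix f w && (rev f == f).
Proof. by rewrite mem_undup mem_filter mem_factors andbC. Qed.

Lemma suffix_comparable (A : eqType) (s t w : seq A) :
  suffix s w -> suffix t w -> size s <= size t -> suffix s t.
Proof.
rewrite -!prefix_rev -(size_rev s) -(size_rev t).
move=> /prefixP[s' es] /prefixP[t' et] le.
apply/prefixP; exists (drop (size (rev s)) (rev t)).
rewrite -{1}(cat_take_drop (size (rev s)) (rev t)); congr (_ ++ _).
have := congr1 (take (size (rev s))) es.
by rewrite take_size_cat // {1}et takel_cat.
Qed.

(** The shorter palindrome is a suffix of the longer one, hence by reversal also a prefix of it, and
    this occurrence ends before the last letter. *)
Lemma pal_suffix_unique (A : eqType) (q1 q2 w : seq A) (x : A) :
  rev q1 = q1 -> rev q2 = q2 ->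
  suffix q1 (rcons w x) -> suffix q2 (rcons w x) -> size q1 < size q2 ->
  infix q1 w.
Proof.
move=> p1 p2 s1 s2 lt.
have : suffix q1 q2 by apply: suffix_comparable s1 s2 _; lia.
rewrite -prefix_rev p1 p2 => /prefixP[r].
case/lastP: r => [|r y] e2; first by move: lt; rewrite e2 cats0 ltnn.
move: s2; rewrite e2 -rcons_cat suffix_rcons => /andP[_ /suffixP[t ->]].
exact: infix_infix.
Qed.

Lemma pal_factors_rcons_old (A : eqType) (w : seq A) (x : A) :
  (forall q, rev q = q -> suffix q (rcons w x) -> infix q w) ->
  size (pal_factors (rcons w x)) <= size (pal_factors w).
Proof.
move=> old; apply: uniq_leq_size; first exact: undup_uniq.
move=> q; rewrite !mem_pal_factors infix_rconsl => /andP[iq /eqP pq].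
by rewrite pq eqxx andbT; case/orP: iq => // /old; apply.
Qed.

(** A palindrome absent from [w] must be a suffix of [rcons w x], and of two palindromic suffixes
    the shorter already occurs in [w]. *)
Lemma pal_factors_rcons (A : eqType) (w : seq A) (x : A) :
  size (pal_factors (rcons w x)) <= (size (pal_factors w)).+1.
Proof.
case E : [seq q <- pal_factors (rcons w x) | ~~ infix q w] => [|q s].
  apply: leqW; apply: uniq_leq_size; first exact: undup_uniq.
  move=> f fx; have : f \notin [seq q <- pal_factors (rcons w x) | ~~ infix q w] by rewrite E.
  rewrite mem_filter fx andbT negbK => fw.
  by move: fx; rewrite !mem_pal_factors fw => /andP[].
apply: (@uniq_leq_size _ _ (q :: pal_factors w)); first exact: undup_uniq.
have newq f : f \in q :: s -> [/\ ~~ infix f w, rev f = f & suffix f (rcons w x)].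
  rewrite -E mem_filter mem_pal_factors infix_rconsl.
  by case/and3P => [/negPf ->]; rewrite orbF => -> /eqP ->.
move=> f fx; rewrite inE mem_pal_factors.
case fw : (infix f w); first by move: fx; rewrite mem_pal_factors => /andP[_ ->]; rewrite orbT.
have fqs : f \in q :: s by rewrite -E mem_filter fw.
have [nf pf sf] := newq _ fqs; have [nq pq sq] := newq _ (mem_head _ _).
have [lt|lt|es] := ltngtP (size f) (size q).
- by move: nf; rewrite (pal_suffix_unique pf pq sf sq lt).
- by move: nq; rewrite (pal_suffix_unique pq pf sq sf lt).
by apply/orP; left; move: sf sq; rewrite !suffixE es => /eqP <-.
Qed.

Lemma size_pal_factors (A : eqType) (w : seq A) : size (pal_factors w) <= (size w).+1.
Proof.
elim/last_ind: w => [//|w x IH]; rewrite size_rcons.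
exact: leq_trans (pal_factors_rcons _ _) _.
Qed.

(** * Strong words and the growth of the defect *)

Definition mirror_infix (A : eqType) (p w : seq A) : bool :=
  infix w p || infix (rev w) p.

Lemma mirror_infix_rev (A : eqType) (p w : seq A) :
  mirror_infix p (rev w) = mirror_infix p w.
Proof. by rewrite /mirror_infix revK orbC. Qed.

Lemma mirror_infix_trans (A : eqType) (p v w : seq A) :
  infix v w -> mirror_infix p w -> mirror_infix p v.
Proof.
move=> vw /orP[|] h; apply/orP; [left|right]; apply: infix_trans h => //.
by rewrite infix_rev.
Qed.

(* The longest palindromic suffix either contains [a w b], hence also its
   mirror image earlier on, or is a suffix of [w b], which already occurred. *)
Lemma no_new_pal (p w : seq bool) (x a b : bool) :
  rev w != w -> suffix (a :: rcons w b) (rcons p x) ->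
  ~~ mirror_infix p (a :: rcons w b) ->
  mirror_infix (rcons p x) (~~ a :: rcons w b) ->
  size (pal_factors (rcons p x)) <= size (pal_factors p).
Proof.
move=> nw sy ny; have sizey v : suffix v (rcons p x) -> size v = size (a :: rcons w b) ->
    v = a :: rcons w b.
  by move=> sv ev; move: sv sy; rewrite !suffixE ev => /eqP -> /eqP.
rewrite {1}/mirror_infix !infix_rconsl => h.
have wb : mirror_infix p (rcons w b).
  apply: (@mirror_infix_trans _ p _ (~~ a :: rcons w b)); first exact: infix_cons.
  case/orP: h => /orP[s|i]; rewrite /mirror_infix ?i ?orbT //.
    by have := sizey _ s erefl; case; case: (a).
  have /= := sizey _ s; rewrite size_rev => /(_ erefl).
  rewrite rev_cons_rcons => -[<-] /rcons_inj[ew _].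
  by rewrite ew eqxx in nw.
apply: pal_factors_rcons_old => q pq sq.
have [le|gt] := leqP (size q) (size (rcons w b)).
  have : suffix q (a :: rcons w b) by apply: suffix_comparable sq sy _; rewrite /= leqW.
  case/suffixP => -[|c t] /= eq; first by move: le; rewrite -eq /= ltnn.
  have iq : infix q (rcons w b) by case: eq => _ ->; apply: suffix_infix.
  by have := mirror_infix_trans iq wb; rewrite /mirror_infix pq orbb.
have : suffix (a :: rcons w b) q by apply: suffix_comparable sy sq _.
rewrite -prefix_rev pq => /prefixP[r].
case/lastP: r => [|r y] eq.
  have := sizey _ sq; rewrite eq cats0 size_rev => /(_ erefl).
  rewrite rev_cons_rcons => -[_] /rcons_inj[ew _].
  by rewrite ew eqxx in nw.
move: sq; rewrite eq -rcons_cat suffix_rcons => /andP[_ /suffixP[t et]].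
by move: ny; rewrite /mirror_infix et infix_infix orbT.
Qed.

Definition strong_in (p w : seq bool) : bool :=
  [forall a, forall b, mirror_infix p (a :: rcons w b)].

(** In the least prefix where [w] is strong, the last letter completes a missing class [a w b], and
    [no_new_pal] applies. This prefix has room for [a w b], whence [size w <= k]. *)
Lemma defect_step (u : nat -> bool) (w : seq bool) (m : nat) :
  rev w != w -> strong_in (Defs.prefix u m) w ->
  exists2 k, size w <= k &
    size (pal_factors (Defs.prefix u k.+1)) <= size (pal_factors (Defs.prefix u k)).
Proof.
move=> nw sm; have ex : exists n, strong_in (Defs.prefix u n) w by exists m.
case: (ex_minnP ex) => -[|k] sk mink.
  by move/forallP: sk => /(_ true)/forallP/(_ true)/orP[] /size_infix;
    rewrite ?size_rev /= size_rcons.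
exists k.
  by move/forallP: sk => /(_ true)/forallP/(_ true)/orP[] /size_infix;
    rewrite /Defs.prefix size_mkseq ?size_rev /= size_rcons => /ltnW.
have : ~~ strong_in (Defs.prefix u k) w by apply/negP => /mink; rewrite ltnn.
rewrite negb_forall => /existsP[a]; rewrite negb_forall => /existsP[b] nab.
have {}sk c d : mirror_infix (rcons (Defs.prefix u k) (u k)) (c :: rcons w d).
  by rewrite /Defs.prefix -mkseqS; move/forallP: sk => /(_ c)/forallP/(_ d).
rewrite {1}/Defs.prefix mkseqS -/(Defs.prefix u k).
have := sk a b; rewrite {1}/mirror_infix !infix_rconsl.
move: (nab); rewrite negb_or => /andP[/negPf -> /negPf ->]; rewrite !orbF.
case/orP => sab; first exact: no_new_pal nw sab nab (sk _ _).
(* The new suffix is the mirror image [b (rev w) a], so [rev w] takes the place of [w]. *)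
rewrite rev_cons_rcons in sab; apply: no_new_pal sab _ _; first by rewrite revK eq_sym.
  by rewrite -rev_cons_rcons mirror_infix_rev.
by rewrite -rev_cons_rcons mirror_infix_rev.
Qed.

(** * Euler characteristics and palindrome counts *)

Fixpoint words (n : nat) : seq (seq bool) :=
  if n is n'.+1 then map (cons true) (words n') ++ map (cons false) (words n')
  else [:: [::]].

Lemma mem_words (n : nat) (w : seq bool) : (w \in words n) = (size w == n).
Proof.
elim: n w => [|n IH] [|a w] //=.
  by rewrite mem_cat; apply/orP => -[] /mapP[].
rewrite mem_cat eqSS -IH; apply/orP/idP => [[] /mapP[v ? [_ ->]] //|wn].
by case: a; [left|right]; apply: map_f.
Qed.

Lemma words_uniq (n : nat) : uniq (words n).
Proof.
elim: n => [//|n IH] /=; rewrite cat_uniq !map_inj_uniq ?IH; try by move=> ? ? [].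
by rewrite andbT; apply/hasPn => w /mapP[v _ ->]; apply/mapP => -[].
Qed.

Lemma sum_words_cons (n : nat) (F : seq bool -> nat) :
  \sum_(w <- words n.+1) F w = \sum_(w <- words n) (F (true :: w) + F (false :: w)).
Proof. by rewrite big_cat !big_map big_split. Qed.

Lemma sum_words_rcons (n : nat) (F : seq bool -> nat) :
  \sum_(w <- words n.+1) F w =
  \sum_(w <- words n) (F (rcons w true) + F (rcons w false)).
Proof.
elim: n F => [|n IH] F; first by rewrite sum_words_cons /= !big_seq1.
rewrite sum_words_cons [LHS]IH [RHS]sum_words_cons.
by apply: eq_bigr => w _ /=; rewrite addnACA.
Qed.

(** A class of two words counts twice and a palindrome once, so the doubled Euler characteristic of
    Gamma_n is [count_words p n + count_pals p n - (count_words p n.+1 - count_pals p n.+1)]. *)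
Definition count_words (p : seq bool) (n : nat) : nat :=
  \sum_(w <- words n) mirror_infix p w.

Definition count_pals (p : seq bool) (n : nat) : nat :=
  \sum_(w <- words n) (mirror_infix p w && (rev w == w)).

Lemma infix_extend (A : eqType) (p w : seq A) :
  infix w p -> size w < size p ->
  exists a, infix (a :: w) p \/ infix (rcons w a) p.
Proof.
move=> /infixP[l [r ->]]; case/lastP: l => [|l a]; last first.
  by exists a; left; rewrite cat_rcons -cat_cons infix_infix.
case: r => [|a r] /=; first by rewrite cats0 ltnn.
by exists a; right; rewrite -cat_rcons; apply: prefix_infix.
Qed.

Lemma mirror_infix_extend (A : eqType) (p w : seq A) :
  mirror_infix p w -> size w < size p ->
  exists a, mirror_infix p (a :: w) \/ mirror_infix p (rcons w a).
Proof.
case/orP => iw lt.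
  by have [a []] := infix_extend iw lt; exists a; [left|right]; apply/orP; left.
have [|a [] h] := infix_extend iw; first by rewrite size_rev.
  by exists a; right; apply/orP; right; rewrite rev_rcons.
by exists a; left; apply/orP; right; rewrite rev_cons.
Qed.

(* The change of the Euler characteristic at the vertex [w], doubled so as to
   count words rather than classes; subtraction-free. *)
Lemma local_count (p w : seq bool) :
  size w < size p -> (rev w == w) || ~~ strong_in p w ->
  mirror_infix p w + (mirror_infix p w && (rev w == w)) +
   (mirror_infix p (true :: rcons w true) + mirror_infix p (true :: rcons w false) +
   (mirror_infix p (false :: rcons w true) + mirror_infix p (false :: rcons w false)))
  <= (mirror_infix p (true :: w) + mirror_infix p (false :: w)) +
     (mirror_infix p (rcons w true) + mirror_infix p (rcons w false)) +
     ((mirror_infix p (true :: rcons w true) && (rev w == w)) +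
      (mirror_infix p (false :: rcons w false) && (rev w == w))).
Proof.
move=> lt ok; set S := mirror_infix p.
have left_ext a b : S (a :: rcons w b) ==> S (a :: w).
  by apply/implyP/mirror_infix_trans; rewrite -rcons_cons; apply: infix_rcons.
have right_ext a b : S (a :: rcons w b) ==> S (rcons w b).
  by apply/implyP/mirror_infix_trans; apply: infix_cons.
have midl a : S (a :: w) ==> S w by apply/implyP/mirror_infix_trans/infix_cons.
have midr a : S (rcons w a) ==> S w by apply/implyP/mirror_infix_trans/infix_rcons.
have ext : S w ==> [|| S (true :: w), S (false :: w), S (rcons w true) | S (rcons w false)].
  apply/implyP => /mirror_infix_extend/(_ lt)[[] []]; rewrite -/S => ->;
  by rewrite ?orbT.
move: ext (midl true) (midl false) (midr true) (midr false).
move: (left_ext true true) (left_ext true false) (left_ext false true)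
  (left_ext false false) (right_ext true true) (right_ext true false)
  (right_ext false true) (right_ext false false).
move: ok; case: eqP => [pal _|_ /=].
  (* For a palindrome, left and right extensions match and the mixed words [1w0], [0w1] form one
     class. What remains is that a one-sided extension exists and that a mixed extension yields both
     letters. *)
  have sym a : S (rcons w a) = S (a :: w).
    by rewrite -[LHS]mirror_infix_rev rev_rcons pal.
  have -> : S (true :: rcons w false) = S (false :: rcons w true).
    by rewrite -[LHS]mirror_infix_rev rev_cons_rcons pal.
  rewrite !sym !andbT.
  by case: (S w); case: (S (true :: w)); case: (S (false :: w));
    case: (S (true :: rcons w true)); case: (S (false :: rcons w true));
    case: (S (false :: rcons w false)).
(* Three extensions [a w b] force all four one-sided ones and two force at least three, so only the
   excluded fourth could break the inequality. *)
move=> ns; have {ns}: ~~ [&& S (true :: rcons w true), S (true :: rcons w false),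
    S (false :: rcons w true) & S (false :: rcons w false)].
  apply: contra ns => /and4P[h1 h2 h3 h4].
  by apply/forallP => -[]; apply/forallP => -[].
rewrite !andbF.
by case: (S w); case: (S (true :: w)); case: (S (false :: w));
  case: (S (rcons w true)); case: (S (rcons w false));
  case: (S (true :: rcons w true)); case: (S (true :: rcons w false));
  case: (S (false :: rcons w true)); case: (S (false :: rcons w false)).
Qed.

(** This is [local_count] summed over the words of length [n]: the doubled Euler characteristic does
    not decrease from [n] to [n.+1]. *)
Lemma count_step (p : seq bool) (n : nat) :
  n < size p -> (forall w, rev w != w -> ~~ strong_in p w) ->
  count_words p n + count_pals p n + count_words p n.+2 <=
  2 * count_words p n.+1 + count_pals p n.+2.
Proof.
move=> lt ns; rewrite mul2n -addnn /count_words /count_pals.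
have sum2 F : \sum_(w <- words n.+2) F w = \sum_(w <- words n)
    ((F (true :: rcons w true) : nat) + F (true :: rcons w false) +
     (F (false :: rcons w true) + F (false :: rcons w false))).
  rewrite sum_words_cons sum_words_rcons.
  by apply: eq_bigr => w _; rewrite addnACA.
rewrite !sum2 {1}sum_words_cons sum_words_rcons -!big_split /=.
rewrite big_seq [X in _ <= X]big_seq; apply: leq_sum => w.
rewrite mem_words => /eqP sw.
have := @local_count p w; rewrite sw => /(_ lt).
rewrite !rev_cons_rcons !eqseq_cons !eqseq_rcons /= !andbT !andbF addn0 add0n.
by apply; case: eqP => //= /eqP /ns.
Qed.

Lemma count_words_big (p : seq bool) (n : nat) : size p < n -> count_words p n = 0.
Proof.
move=> lt; rewrite /count_words big_seq big1 // => w; rewrite mem_words => /eqP sw.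
by apply/eqP; rewrite eqb0; apply/norP; split; apply/negP => /size_infix;
  rewrite ?size_rev sw leqNgt lt.
Qed.

(** The bounds [euler n] for [n < k] are added: [count_words] telescopes, and each palindrome of
    length from 1 to [k - 1] is counted at two consecutive [n]. The initial [count_words p 0 = 1]
    supplies the second count of the empty word. *)
Lemma count_sum (p : seq bool) (k : nat) :
  (forall w, rev w != w -> ~~ strong_in p w) -> k <= (size p).+1 ->
  2 * k + count_words p k <= 2 * (\sum_(n < k) count_pals p n) + count_pals p k.
Proof.
move=> ns.
have c0 : count_words p 0 = 1 by rewrite /count_words big_seq1 /mirror_infix /= infix0s.
have p0 : count_pals p 0 = 1 by rewrite /count_pals big_seq1 /mirror_infix /= infix0s.
have c1 : count_words p 1 = count_pals p 1.
  rewrite /count_words /count_pals !sum_words_cons !big_seq1.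
  by rewrite !andbT.
(* Twice the Euler characteristic of Gamma_n is at least 2. *)
have euler n : n <= size p ->
    2 + count_words p n.+1 <= count_words p n + count_pals p n + count_pals p n.+1.
  elim: n => [|n IH] le; first by rewrite c0 p0 c1.
  have := count_step le ns; have := IH (ltnW le); lia.
elim: k => [|k IH] le; first by rewrite big_ord0 c0 p0.
rewrite big_ord_recr /=; have := IH (ltnW le); have := euler k le.
move: (\sum_(n < k) _) => t; lia.
Qed.

Lemma count_pals_le (p : seq bool) (k : nat) :
  \sum_(n < k) count_pals p n <= size (pal_factors p).
Proof.
pose s := [seq w <- [seq w | n <- iota 0 k, w <- words n] | mirror_infix p w && (rev w == w)].
have -> : \sum_(n < k) count_pals p n = size s.
  rewrite size_filter -sum1_count /= big_flatten big_map.
  rewrite -(big_mkord xpredT (count_pals p)) /index_iota subn0.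
  by apply: eq_bigr => n _; rewrite big_map [RHS]big_mkcond; apply: eq_bigr => w _; case: (_ && _).
apply: uniq_leq_size => [|w].
  apply/filter_uniq/allpairs_uniq_dep; first exact: iota_uniq.
    by move=> n _; apply: words_uniq.
  move=> _ _ /allpairsPdep[n [v [_ + ->]]] /allpairsPdep[m [w [_ + ->]]] /= e.
  by rewrite !mem_words => /eqP <- /eqP <-; rewrite e.
rewrite mem_filter mem_pal_factors => /andP[/andP[+ /eqP pw] _].
by rewrite /mirror_infix pw orbb eqxx andbT.
Qed.

(** Without such a word, [count_sum] at [k = size p + 1], a length that no factor reaches, yields
    [size p + 1] distinct palindromes. *)
Lemma strong_of_defect (p : seq bool) :
  size (pal_factors p) <= size p -> exists2 w, rev w != w & strong_in p w.
Proof.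
move=> le.
(* Since [a w b] must fit into [p], lengths below [size p] suffice and the search is finite. *)
have [/hasP[w _ /andP[nw sw]]|/hasPn none] := boolP
  (has (fun w => (rev w != w) && strong_in p w) (flatten (map words (iota 0 (size p))))).
  by exists w.
have ns w : rev w != w -> ~~ strong_in p w.
  move=> nw; apply/negP => sw.
  suff wf : w \in flatten (map words (iota 0 (size p))).
    by have := none _ wf; rewrite nw sw.
  apply/flatten_mapP; exists (size w); last by rewrite mem_words.
  rewrite mem_iota /=; move: sw => /forallP/(_ true)/forallP/(_ true)/orP[] /size_infix;
  by rewrite ?size_rev /= size_rcons => /ltnW.
have := count_sum ns (leqnn _); have := count_pals_le p (size p).+1.
have -> : count_pals p (size p).+1 = 0.
  apply/eqP; rewrite -leqn0 -[X in _ <= X](count_words_big (ltnSn (size p))).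
  by apply: leq_sum => w _; case: (mirror_infix p w); case: eqP.
lia.
Qed.

(** * Factors of fixed points and uniform recurrence *)

Section Language.
Context (A : eqType).
Implicit Types (u : nat -> A) (f g : seq A) (phi : A -> seq A).

Definition lang u f : Prop := exists n, infix f (Defs.prefix u n).

Lemma lang_infix u f g : infix f g -> lang u g -> lang u f.
Proof. by move=> fg [n gn]; exists n; apply: infix_trans gn. Qed.

Lemma prefixD u m n : Defs.prefix u (m + n) = Defs.prefix u m ++ factor_at u m n.
Proof.
rewrite /Defs.prefix /factor_at /mkseq iotaD map_cat add0n; congr (_ ++ _).
have -> : iota m n = map (addn m) (iota 0 n) by rewrite -iotaDl addn0.
by rewrite -map_comp.
Qed.

Lemma lang_factor_at u i n : lang u (factor_at u i n).
Proof. by exists (i + n); rewrite prefixD; apply: suffix_infix. Qed.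

Lemma infix_prefix_le u m n : m <= n -> infix (Defs.prefix u m) (Defs.prefix u n).
Proof. by move=> /subnKC <-; rewrite prefixD; apply: prefix_infix. Qed.

Lemma morph_cat phi f g : morph phi (f ++ g) = morph phi f ++ morph phi g.
Proof. by rewrite /morph map_cat flatten_cat. Qed.

Lemma morph_rcons phi f a : morph phi (rcons f a) = morph phi f ++ phi a.
Proof. by rewrite -cats1 morph_cat /morph /= cats0. Qed.

Lemma morph_infix phi f g : infix f g -> infix (morph phi f) (morph phi g).
Proof. by move=> /infixP[s [t ->]]; rewrite !morph_cat infix_infix. Qed.

Lemma size_morph phi k f : (forall a, k <= size (phi a)) -> k * size f <= size (morph phi f).
Proof.
move=> h; elim: f => [|a f IH]; first by rewrite muln0.
by rewrite /morph /= size_cat mulnS leq_add.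
Qed.

Lemma lang_morph phi u f : fixed_point phi u -> lang u f -> lang u (morph phi f).
Proof.
move=> fix_u [n fn]; exists (size (morph phi (Defs.prefix u n))).
by rewrite -fix_u; apply: morph_infix.
Qed.

Lemma iter_morph_cat phi k f g :
  iter k (morph phi) (f ++ g) = iter k (morph phi) f ++ iter k (morph phi) g.
Proof. by elim: k => //= k ->; rewrite morph_cat. Qed.

Lemma morph_iter phi k f :
  morph (fun a => iter k (morph phi) [:: a]) f = iter k (morph phi) f.
Proof.
elim: f => [|a f IH]; first by elim: k => //= k <-.
by rewrite -[in RHS]cat1s iter_morph_cat -IH.
Qed.

Lemma fixed_point_iter phi u k :
  fixed_point phi u -> fixed_point (fun a => iter k (morph phi) [:: a]) u.
Proof.
move=> fix_u n; rewrite morph_iter; elim: k => [|k IH] /=; first by rewrite size_mkseq.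
by rewrite {1}IH fix_u -IH.
Qed.

(** Recurrence places [f] in a window starting at position [k]; the [k] letters before and after the
    window provide the margins. *)
Lemma lang_extend u f k :
  (forall g, lang u g -> exists M, forall h, lang u h -> M <= size h -> infix g h) ->
  lang u f -> exists x y, [/\ k <= size x, k <= size y & lang u (x ++ f ++ y)].
Proof.
move=> rec lf; have [M hM] := rec f lf.
have /infixP[x [y e]] : infix f (factor_at u k M).
  by apply: hM; [apply: lang_factor_at | rewrite size_mkseq].
exists (Defs.prefix u k ++ x), (y ++ factor_at u (k + M) k); split.
- by rewrite size_cat size_mkseq leq_addr.
- by rewrite size_cat size_mkseq leq_addl.
exists (k + M + k); rewrite !prefixD e -!catA; exact: infix_refl.
Qed.

Lemma infix_cat (f x y : seq A) : infix f (x ++ y) ->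
  infix f y \/ exists f1 f2, [/\ f = f1 ++ f2, size f1 <= size x & prefix f2 y].
Proof.
elim: x f => [|a x IH] f; first by left.
rewrite cat_cons infix_consl => /orP[|/IH[]]; first last.
- by case=> f1 [f2 [-> le pf]]; right; exists f1, f2; rewrite leqW.
- by left.
rewrite -cat_cons => /prefixP[s e]; right.
exists (take (size x).+1 f), (drop (size x).+1 f).
rewrite cat_take_drop size_take_min geq_minl; split => //.
have := congr1 (drop (size x).+1) e; rewrite drop_size_cat // drop_cat.
case: ltnP => [_ ->|le _]; first exact: prefix_prefix.
by rewrite drop_oversize // prefix0s.
Qed.

(** If [g] starts inside some block, at most [K] letters are spent there, and the remaining [K] or
    more cover the next block. *)
Lemma infix_morph phi K f g :
  (forall a, 0 < size (phi a) <= K) -> infix g (morph phi f) -> 2 * K <= size g ->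
  f != [::] -> exists a, infix (phi a) g.
Proof.
move=> hK; elim: f => [//|a f IH] /=; rewrite /morph /= -/(morph phi f).
move=> /infix_cat[ig|[g1 [g2 [eg le pg]]]] sg _.
  case: f IH ig => [|b f] IH ig; last exact: IH.
  have /andP[] := hK a; move: (size_infix ig); rewrite /=; lia.
have /andP[_ ha] := hK a; have sg2 : K <= size g2 by move: sg; rewrite eg size_cat; lia.
case: f pg {IH} => [|b f] /prefixP[s].
  rewrite /morph /= => /(congr1 size); rewrite size_cat /=.
  by have /andP[] := hK a; lia.
have /andP[_ hb] := hK b; rewrite /morph /= => e; exists b.
rewrite eg; apply: infix_catl; apply/prefixW/prefixP.
exists (drop (size (phi b)) g2); rewrite -{1}(cat_take_drop (size (phi b)) g2).
congr (_ ++ _); have := congr1 (take (size (phi b))) e.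
by rewrite take_size_cat // takel_cat //; apply: leq_trans sg2.
Qed.

End Language.

(** Some iterate of [u 0] contains [f], and one further iterate of any letter contains that one. A
    long factor contains a complete block of this iterate. *)
Lemma uniform_recurrence (phi : bool -> seq bool) (u : nat -> bool) :
  (forall a b, b \in phi a) -> fixed_point phi u ->
  forall f, lang u f -> exists M, forall g, lang u g -> M <= size g -> infix f g.
Proof.
move=> full fix_u f [n fn].
have two a : 2 <= size (phi a).
  by have := full a true; have := full a false; case: (phi a) => [|[] [|]].
have grow v k : size v <= size (iter k (morph phi) v).
  elim: k => //= k le; apply: leq_trans le _.
  by apply: leq_trans (size_morph _ two); rewrite leq_pmull.
have fm : infix f (iter n (morph phi) [:: u 0]).
  apply: infix_trans fn _.
  have [m lt ->] : exists2 m, n < m & iter n (morph phi) [:: u 0] = Defs.prefix u m.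
    elim: n => [|n [m lt IH]] /=; first by exists 1.
    exists (size (morph phi (Defs.prefix u m))); last by rewrite IH; apply: fix_u.
    by have := size_morph (Defs.prefix u m) two; rewrite size_mkseq; lia.
  by apply/infix_prefix_le/ltnW.
pose psi a := iter n.+1 (morph phi) [:: a].
have fpsi a : infix f (psi a).
  apply: infix_trans fm _; rewrite /psi iterSr -!(morph_iter phi n).
  by apply: morph_infix; rewrite infix1s /morph /= cats0.
have psi_gt0 a : 0 < size (psi a) by have := grow [:: a] n.+1.
pose K := maxn (size (psi true)) (size (psi false)).
have psiK a : 0 < size (psi a) <= K.
  by rewrite psi_gt0 /K; case: a; rewrite ?leq_maxl ?leq_maxr.
exists (2 * K) => g [j gj] leg.
have [|||a] := @infix_morph _ psi K (Defs.prefix u j) g psiK.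
- rewrite (fixed_point_iter n.+1 fix_u); apply: infix_trans gj _.
  apply: infix_prefix_le.
  by have := @size_morph _ psi 1 (Defs.prefix u j) psi_gt0; rewrite size_mkseq mul1n.
- exact: leg.
- case: j gj => [|j] // /size_infix /= gj; exfalso.
  have /andP[gt0 leK] := psiK true; move: (leq_trans leg gj) (leq_trans gt0 leK).
  by case: (K).
exact: infix_trans.
Qed.

(** * Consequences of finite defect *)

Lemma finite_defect_prefix (A : eqType) (u : nat -> A) :
  finite_defect u ->
  exists M, forall n, n < size (pal_factors (Defs.prefix u n)) + M.
Proof.
move=> [D hD]; exists `|D|%N => n; have := hD 0 n.
rewrite /defect size_mkseq -[factor_at u 0 n]/(Defs.prefix u n).
move: (size _) => s; lia.
Qed.

(** Finite defect provides arbitrarily long palindromes; one of length at least [M] contains [f],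
    hence [rev f]. *)
Lemma lang_rev (u : nat -> bool) :
  (forall f, lang u f -> exists M, forall g, lang u g -> M <= size g -> infix f g) ->
  finite_defect u -> forall f, lang u f -> lang u (rev f).
Proof.
move=> rec /finite_defect_prefix[D hD] f lf; have [M hM] := rec f lf.
pose short := flatten (map words (iota 0 M)).
have lpal n : has (fun q => M <= size q) (pal_factors (Defs.prefix u n)) -> lang u (rev f).
  move=> /hasP[q]; rewrite mem_pal_factors => /andP[qn /eqP pq] lq.
  have lgq : lang u q by exists n.
  by apply: lang_infix lgq; rewrite -pq infix_rev; apply: hM => //; exists n.
(* This prefix has more than [size short] palindromic factors, too many for all of them to be
   shorter than [M]. *)
apply: (lpal (size short + D)); apply/hasPn => none.
have le : size (pal_factors (Defs.prefix u (size short + D))) <= size short.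
  apply: uniq_leq_size => [|q /none]; first exact: undup_uniq.
  rewrite -ltnNge => lt; apply/flatten_mapP; exists (size q); last by rewrite mem_words.
  by rewrite mem_iota.
by have := leq_trans (hD _) (leq_add le (leqnn D)); rewrite ltnn.
Qed.

(** The defect of prefixes never decreases, by [pal_factors_rcons]. A strong non-palindrome of
    length at least [n] makes it increase at a position beyond [n], so the increases accumulate. *)
Lemma defect_prefix_unbounded (u : nat -> bool) :
  (forall n, exists w, [/\ n <= size w, rev w != w & exists m, strong_in (Defs.prefix u m) w]) ->
  ~ finite_defect u.
Proof.
move=> st /finite_defect_prefix[D hD].
have grow d : exists n, d + size (pal_factors (Defs.prefix u n)) <= n.+1.
  elim: d => [|d [n le]].
    by exists 0; have := size_pal_factors (Defs.prefix u 0).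
  have [w [nw pw [m sm]]] := st n; have [k lek step] := defect_step pw sm.
  exists k.+1; suff : d + size (pal_factors (Defs.prefix u k)) <= k.+1 by lia.
  have := leq_trans nw lek.
  elim: k {step lek} => [|k IH]; first by rewrite leqn0 => /eqP n0; rewrite n0 in le.
  rewrite leq_eqVlt => /orP[/eqP <- //|]; rewrite ltnS => /IH.
  have -> : Defs.prefix u k.+1 = rcons (Defs.prefix u k) (u k) by apply: mkseqS.
  have := pal_factors_rcons (Defs.prefix u k) (u k).
  by move: (size _) (size _) => s t; lia.
have [n] := grow D.+1; have := hD n; rewrite addnC => h1 h2.
by have := leq_trans h1 h2; rewrite ltnn.
Qed.

Lemma strong_inP (u : nat -> bool) (w : seq bool) :
  (exists m, strong_in (Defs.prefix u m) w) <->
  (forall a b, lang u (a :: rcons w b) \/ lang u (rev (a :: rcons w b))).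
Proof.
split=> [[m /forallP sm] a b|h].
  by have /forallP/(_ b)/orP[i|i] := sm a; [left|right]; exists m.
have {}h a b : exists m, forall n, m <= n -> mirror_infix (Defs.prefix u n) (a :: rcons w b).
  by case: (h a b) => -[m i]; exists m => n /(infix_prefix_le u) le;
    apply/orP; [left|right]; apply: infix_trans le.
have [m1 h1] := h true true; have [m2 h2] := h true false.
have [m3 h3] := h false true; have [m4 h4] := h false false.
exists (m1 + m2 + m3 + m4); apply/forallP => a; apply/forallP => b.
by case: a; case: b; [apply: h1|apply: h2|apply: h3|apply: h4]; lia.
Qed.

(** * Conjugation of the morphism and images of strong words *)

Lemma first_difference (A : eqType) (v w : seq A) :
  size v = size w -> v <> w ->
  exists z a b v' w', [/\ v = z ++ a :: v', w = z ++ b :: w' & a <> b].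
Proof.
elim: v w => [|a v IH] [|b w] //= [es] ne.
have [eab|nab] := eqVneq a b; last by exists [::], a, b, v, w; split=> //; apply/eqP.
have [|z [c [d [v' [w' [ev ew cd]]]]]] := IH w es; first by move=> e; apply: ne; rewrite eab e.
by exists (a :: z), c, d, v', w'; rewrite ev ew eab.
Qed.

Lemma cat_eq_prefix (A : eqType) (x y s t : seq A) :
  x ++ y = s ++ t -> size s <= size x -> exists r, x = s ++ r.
Proof.
move=> + le => /(congr1 (take (size s))); rewrite takel_cat // take_size_cat // => <-.
by exists (drop (size s) x); rewrite cat_take_drop.
Qed.

(* [p] is the longest common prefix of [phi true ++ phi false] and
   [phi false ++ phi true]. *)
Lemma conjugate_right (phi : bool -> seq bool) :
  phi true ++ phi false <> phi false ++ phi true ->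
  exists p (beta : bool -> bool) (t : bool -> seq bool),
    injective beta /\ forall a, phi a ++ p = p ++ beta a :: t a.
Proof.
move=> nc; have [|p [c [d [v [w [ev ew cd]]]]]] := first_difference _ nc.
  by rewrite !size_cat addnC.
have extend x y e r : 0 < size x -> x ++ p ++ y = p ++ e :: r ->
    exists s, x ++ p = p ++ e :: s.
  rewrite catA -cat_rcons => lt /cat_eq_prefix[|s ->]; first by rewrite size_rcons size_cat; lia.
  by exists s; rewrite cat_rcons.
(* The word [phi true ++ phi false ++ phi true] is read in two ways; an empty [phi true] would
   commute. *)
have [||t1 e1] := extend (phi true) (d :: w) c (v ++ phi true).
- by move: nc; case: (phi true) => //; rewrite cats0.
- by rewrite -ew -cat_cons [RHS]catA -ev -catA.
have [||t0 e0] := extend (phi false) (c :: v) d (w ++ phi false).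
- by move: nc; case: (phi false) => //; rewrite cats0.
- by rewrite -ev -cat_cons [RHS]catA -ew -catA.
exists p, (fun a => if a then c else d), (fun a => if a then t1 else t0).
by split=> [|[]] // [] [] //= e; case: cd.
Qed.

(** This is [conjugate_right] for the morphism with reversed images. *)
Lemma conjugate_left (phi : bool -> seq bool) :
  phi true ++ phi false <> phi false ++ phi true ->
  exists s (alpha : bool -> bool) (t : bool -> seq bool),
    injective alpha /\ forall a, s ++ phi a = rcons (t a) (alpha a) ++ s.
Proof.
move=> nc; have [|p [alpha [t [inj e]]]] := @conjugate_right (fun a => rev (phi a)).
  by rewrite -!rev_cat => /(can_inj (@revK _)) h; apply: nc.
exists (rev p), alpha, (fun a => rev (t a)); split=> // a.
by rewrite -[phi a]revK -rev_cat e rev_cat rev_cons.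
Qed.

Lemma injective_bool_involutive (beta : bool -> bool) :
  injective beta -> forall a, beta (beta a) = a.
Proof.
move=> inj a; have := inj true false.
by case ht : (beta true); case hf : (beta false) => // h;
  try (by have := h erefl); case: a; rewrite ?ht ?hf ?ht ?hf.
Qed.

Section Conjugates.
Context (phi : bool -> seq bool) (p s : seq bool).
Context (alpha beta : bool -> bool) (tl tr : bool -> seq bool).
Context (right_conj : forall a, phi a ++ p = p ++ beta a :: tr a).
Context (left_conj : forall a, s ++ phi a = rcons (tl a) (alpha a) ++ s).

Definition bispecial_image (w : seq bool) : seq bool := s ++ morph phi w ++ p.

Lemma morph_right_conj w : exists r, morph phi w ++ p = p ++ r.
Proof.
elim: w => [|a w [r IH]]; first by exists [::]; rewrite cats0.
exists (beta a :: tr a ++ r).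
by rewrite /morph /= -/(morph phi w) -catA IH catA right_conj -catA.
Qed.

Lemma morph_left_conj w : exists r, s ++ morph phi w = r ++ s.
Proof.
elim/last_ind: w => [|w a [r IH]]; first by exists [::]; rewrite cats0.
exists (r ++ rcons (tl a) (alpha a)).
by rewrite morph_rcons catA IH -!catA left_conj.
Qed.

(** The final [p] moves left across [phi m] and then [phi a], where it releases the letter
    [beta a]. *)
Lemma bispecial_image_prefix z a m :
  exists r, bispecial_image (z ++ a :: m) = bispecial_image z ++ beta a :: r.
Proof.
have [r e] := morph_right_conj m; exists (tr a ++ r).
rewrite /bispecial_image morph_cat /morph /= -/(morph phi z) -/(morph phi m).
by rewrite -!catA e (catA (phi a)) right_conj -catA.
Qed.

Lemma bispecial_image_suffix z a m :
  exists r, bispecial_image (m ++ a :: z) = r ++ alpha a :: bispecial_image z.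
Proof.
have [r e] := morph_left_conj m; exists (r ++ tl a).
rewrite /bispecial_image morph_cat /morph /= -/(morph phi z) -/(morph phi m).
by rewrite catA catA e -!catA (catA s) left_conj cat_rcons -!catA.
Qed.

Lemma perm_bispecial_image v w :
  perm_eq v w -> perm_eq (bispecial_image v) (bispecial_image w).
Proof. by move=> vw; rewrite /bispecial_image perm_cat2l perm_cat2r perm_flatten // perm_map. Qed.

(** Write [w] with prefix [z b] and suffix [a (rev z)], where [a <> b]. The double image shows [b]
    and [a] again at mirror positions. A single image would show [beta b] and [alpha a], which may
    agree. *)
Lemma bispecial_image2_nonpal w : injective alpha -> injective beta ->
  rev w != w -> rev (bispecial_image (bispecial_image w)) != bispecial_image (bispecial_image w).
Proof.
move=> inja injb /eqP nw.
have [|z [a [b [v [v' [ev ew ab]]]]]] := first_difference _ nw; first by rewrite size_rev.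
have ew' : w = rev v ++ a :: rev z by rewrite -[w]revK ev rev_cat rev_cons cat_rcons.
have [r1 e1] := bispecial_image_prefix z b v'.
have [r2 e2] := bispecial_image_prefix (bispecial_image z) (beta b) r1.
have [r3 e3] := bispecial_image_suffix (rev z) a (rev v).
have [r4 e4] := bispecial_image_suffix (bispecial_image (rev z)) (alpha a) r3.
rewrite -e1 -ew injective_bool_involutive // in e2.
rewrite -e3 -ew' injective_bool_involutive // in e4.
apply/eqP => pal; apply: ab.
have es : size (rev (bispecial_image (bispecial_image (rev z)))) =
          size (bispecial_image (bispecial_image z)).
  by rewrite size_rev; apply/perm_size/perm_bispecial_image/perm_bispecial_image; rewrite perm_rev.
have := congr1 (fun q => nth true q (size (bispecial_image (bispecial_image z)))) pal.
rewrite [in LHS]e4 [in RHS]e2 rev_cat rev_cons cat_rcons -es.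
by rewrite nth_cat ltnn subnn es nth_cat ltnn subnn.
Qed.

Lemma size_bispecial_image k w :
  (forall a, k <= size (phi a)) -> k * size w <= size (bispecial_image w).
Proof.
move=> le; apply: leq_trans (size_morph w le) _.
by rewrite /bispecial_image !size_cat addnCA leq_addr.
Qed.

(** Extend [a w b] to [x a w b y] with long margins. Then [phi b] followed by the image of [y]
    starts with [p] and [beta b], and the image of [x] followed by [phi a] ends with [alpha a] and
    [s]. *)
Lemma lang_bispecial_image (u : nat -> bool) a w b :
  (forall c, 0 < size (phi c)) -> fixed_point phi u ->
  (forall f, lang u f -> exists M, forall g, lang u g -> M <= size g -> infix f g) ->
  lang u (a :: rcons w b) -> lang u (alpha a :: rcons (bispecial_image w) (beta b)).
Proof.
move=> pos fix_u rec /(lang_extend (size p + size s) rec)[x [y [lx ly]]].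
move=> /(lang_morph fix_u); apply: lang_infix.
have [r er] := morph_right_conj y; have [l el] := morph_left_conj x.
have sy : size p <= size (morph phi y).
  by apply: leq_trans (leq_trans (leq_addr _ _) ly) _; rewrite -[size y]mul1n size_morph.
have sx : size s <= size (morph phi x).
  by apply: leq_trans (leq_trans (leq_addl _ _) lx) _; rewrite -[size x]mul1n size_morph.
have [r' ey] : exists r', phi b ++ morph phi y = p ++ beta b :: r'.
  have e : (phi b ++ morph phi y) ++ p = rcons p (beta b) ++ (tr b ++ r).
    by rewrite -catA er catA right_conj cat_rcons -catA.
  have [|r' ->] := cat_eq_prefix e; last by exists r'; rewrite cat_rcons.
  by rewrite size_rcons size_cat -add1n leq_add.
(* The left side is the mirror case, so [cat_eq_prefix] is applied to reversals. *)
have [l' ex] : exists l', morph phi x ++ phi a = l' ++ alpha a :: s.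
  have e : rev (morph phi x ++ phi a) ++ rev s = rev (alpha a :: s) ++ rev (l ++ tl a).
    by rewrite -!rev_cat catA el -!catA left_conj cat_rcons.
  have [|r2 e2] := cat_eq_prefix e; last first.
    by exists (rev r2); rewrite -[LHS]revK e2 rev_cat revK.
  by rewrite !size_rev size_cat /= -addn1 leq_add.
have -> : morph phi (x ++ (a :: rcons w b) ++ y) =
    l' ++ (alpha a :: rcons (bispecial_image w) (beta b)) ++ r'.
  rewrite !morph_cat -cat1s morph_cat morph_rcons {2}/morph /= cats0.
  rewrite -!catA ey (catA (morph phi x)) ex /bispecial_image.
  by rewrite -!catA /= cat_rcons -!catA.
exact: infix_infix.
Qed.

End Conjugates.

(** * The commuting and non-commuting cases *)

Lemma periodic_of_commute (phi : bool -> seq bool) (u : nat -> bool) :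
  (forall a, 0 < size (phi a)) -> fixed_point phi u ->
  phi true ++ phi false = phi false ++ phi true -> periodic u.
Proof.
move=> pos fix_u comm; exists (size (phi true)); split=> // n.
have commw w : phi true ++ morph phi w = morph phi w ++ phi true.
  elim: w => [|a w IH]; first by rewrite cats0.
  rewrite /morph /= -/(morph phi w) -catA -IH !catA; congr (_ ++ _).
  by case: a.
have nthm i j : i < j -> nth true (morph phi (Defs.prefix u j)) i = u i.
  move=> lt; rewrite fix_u nth_mkseq //; apply: leq_trans lt _.
  by have := size_morph (Defs.prefix u j) pos; rewrite mul1n size_mkseq.
(* At this position the left side shows [u n], shifted by [phi true], and the right side
   [u (n + size (phi true))]. *)
have := congr1 (fun w => nth true w (n + size (phi true)))
  (commw (Defs.prefix u (n + size (phi true)).+1)).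
rewrite nth_cat ltnNge leq_addl /= addnK nthm; last by lia.
rewrite nth_cat; have := size_morph (Defs.prefix u (n + size (phi true)).+1) pos.
by rewrite mul1n size_mkseq => ->; rewrite nthm.
Qed.

Lemma unbounded_strong (phi : bool -> seq bool) (u : nat -> bool) (w : seq bool) :
  (forall a, 1 < size (phi a)) -> fixed_point phi u ->
  (forall f, lang u f -> exists M, forall g, lang u g -> M <= size g -> infix f g) ->
  phi true ++ phi false <> phi false ++ phi true ->
  rev w != w -> (forall a b, lang u (a :: rcons w b)) ->
  forall n, exists w', [/\ n <= size w', rev w' != w' & forall a b, lang u (a :: rcons w' b)].
Proof.
move=> two fix_u rec nc nw sw.
have [p [beta [tr [injb rc]]]] := conjugate_right nc.
have [s [alpha [tl [inja lc]]]] := conjugate_left nc.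
have pos a : 0 < size (phi a) by apply: ltnW.
have step v : (forall a b, lang u (a :: rcons v b)) ->
    forall a b, lang u (a :: rcons (bispecial_image phi p s v) b).
  (* As [alpha] and [beta] are involutions, every pair of letters arises from an extension of
     [v]. *)
  move=> sv a b; rewrite -(injective_bool_involutive inja a) -(injective_bool_involutive injb b).
  exact: (lang_bispecial_image rc lc).
elim=> [|n [v [lv nv sv]]]; first by exists w.
exists (bispecial_image phi p s (bispecial_image phi p s v)); split.
- have h := size_bispecial_image p s _ two.
  (* A non-palindrome is not empty, so doubling its length strictly increases it. *)
  have v0 : 0 < size v by case: (v) nv.
  apply: leq_trans (leq_trans (leq_pmull _ _) (h _)) => //.
  by apply: leq_trans (h _); rewrite mul2n -addnn -addn1 leq_add.
- exact: (bispecial_image2_nonpal rc lc).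
exact: step (step _ sv).
Qed.

Theorem theorem24 (phi : bool -> seq bool) (u : nat -> bool) :
  primitive phi -> fixed_point phi u -> finite_defect u ->
  zero_defect u \/ periodic u.
Proof.
(* Passing to a power [psi] of [phi] makes every image contain both letters and keeps [u] fixed. *)
move=> [k full] /(fixed_point_iter k); set psi := fun a => _ => fix_u fin.
have two a : 1 < size (psi a).
  by have := full a true; have := full a false; rewrite -/(psi a); case: (psi a) => [|[] [|]].
have pos a : 0 < size (psi a) by apply: ltnW.
have rec := uniform_recurrence full fix_u.
have [comm|/eqP nc] := eqVneq (psi true ++ psi false) (psi false ++ psi true).
  by right; apply: periodic_of_commute comm.
left=> i n; apply/eqP; apply/negPn/negP => /eqP nz.
have le : size (pal_factors (factor_at u i n)) <= size (factor_at u i n).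
  have := size_pal_factors (factor_at u i n); move: nz; rewrite /defect.
  by move: (size _) (size _) => x y; lia.
have [w nw /forallP sw] := strong_of_defect le.
(* Closure under reversal turns occurrence up to reversal into occurrence of all four words. *)
have lu : forall a b, lang u (a :: rcons w b).
  move=> a b; have /forallP/(_ b)/orP[] := sw a => ifx.
    exact: lang_infix ifx (lang_factor_at _ _ _).
  by rewrite -[_ :: _]revK; apply: lang_rev => //; apply: lang_infix ifx (lang_factor_at _ _ _).
apply: defect_prefix_unbounded fin => m.
have [v [lv nv sv]] := unbounded_strong two fix_u rec nc nw lu m.
by exists v; split=> //; apply/strong_inP => a b; left.
Qed.
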